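(* Fix positive integers $s\geq 2$ and $d$. For a positive integer $h$, set $n=n(h):=\sum_{i=0}^h s^i$ and let $T_h$ be the balanced $s$-ary tree of height $h$ (which has $n$ vertices). Let $r^*=r^*(h):=\sqrt{d}/(2h)$. Then $r^*$ is a sharp threshold for $\mathcal{G}(n,r,d)$ to contain a copy of $T_h$; that is, for every fixed $\epsilon\in(0,1)$, as $h\to\infty$ we have $\mathbb{P}[\mathcal{G}(n,r,d)\text{ contains a copy of } T_h]\to 0$ whenever $r\leq(1-\epsilon)r^*$, and $\mathbb{P}[\mathcal{G}(n,r,d)\text{ contains a copy of } T_h]\to 1$ whenever $r\geq(1+\epsilon)r^*$.
   Context: The random geometric graph $\mathcal{G}(n,r,d)$ has as vertex set $n$ points sampled independently and uniformly at random from $[0,1]^d$, two vertices being adjacent if their Euclidean distance is at most $r$. For a rooted tree, the layer $V_i$ is the set of vertices at graph distance $i$ from the root; the height is the largest $h$ with $V_h$ nonempty; the children of a vertex in $V_j$ are its neighbours in $V_{j+1}$. The balanced $s$-ary tree of height $h$ is the rooted tree of height $h$ in which every vertex in $V_0,\dots,V_{h-1}$ has exactly $s$ children. ''Contains a copy of'' means contains a subgraph isomorphic to it (here necessarily spanning). *)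

(* Defs.v *)
From HB Require Import structures.
From mathcomp Require Import all_boot all_order all_algebra.
From mathcomp Require Import all_classical all_reals all_analysis.
Set Implicit Arguments. Unset Strict Implicit. Unset Printing Implicit Defensive.
Import Order.TTheory GRing.Theory Num.Theory.
Import numFieldNormedType.Exports.
Local Open Scope classical_set_scope.
Local Open Scope ring_scope.

(** * Uniform product measure on [0,1]^I (I finite), as an iterated
    Lebesgue integral over the coordinates listed in [cs]:
    [iter_unif_int cs f x0] integrates [f] with respect to every coordinate
    in [cs] over [0,1] (Lebesgue measure), the remaining coordinates being
    those of [x0]. *)
Fixpoint iter_unif_int (R : realType) (I : eqType) (cs : seq I)
    (f : (I -> R) -> \bar R) (x0 : I -> R) : \bar R :=
  match cs with
  | [::] => f x0
  | i :: cs' =>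
      (\int[@lebesgue_measure R]_(t in `[0%R, 1%R])
         iter_unif_int cs' f (fun j => if j == i then t else x0 j))%E
  end.

Definition unif_prob (R : realType) (I : finType) (E : set (I -> R)) : \bar R :=
  iter_unif_int (enum I) (fun x => (\1_E x)%:E) (fun _ => 0).

Definition eucl_dist (R : realType) (d : nat) (x y : 'I_d -> R) : R :=
  Num.sqrt (\sum_(k < d) (x k - y k) ^+ 2).

Definition rgg_adj (R : realType) (n d : nat) (r : R)
    (X : 'I_n -> 'I_d -> R) (i j : 'I_n) : Prop :=
  i != j /\ eucl_dist (X i) (X j) <= r.

(** The balanced s-ary tree of height h: vertices are the words over the
    alphabet 'I_s of length at most h (the root is the empty word, layer V_i
    consists of the words of length i), and the children of a word w are the
    words [rcons w a], a : 'I_s. *)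
Definition bal_tree_vertex (s h : nat) (w : seq 'I_s) : Prop := (size w <= h)%N.
Definition bal_tree_edge (s : nat) (u v : seq 'I_s) : Prop :=
  (exists a, v = rcons u a) \/ (exists a, u = rcons v a).

Definition contains_copy (T : Type) (V : set T) (E : T -> T -> Prop)
    (n : nat) (adj : 'I_n -> 'I_n -> Prop) : Prop :=
  exists phi : T -> 'I_n,
    (forall u v, V u -> V v -> phi u = phi v -> u = v) /\
    (forall u v, V u -> V v -> E u v -> adj (phi u) (phi v)).

Definition ntree (s h : nat) : nat := (\sum_(i < h.+1) s ^ i)%N.

(** P[ G(n,r,d) contains a copy of T_h ], n = n(h); the n points are
    independent uniform in [0,1]^d, i.e. the n*d coordinates are iid U[0,1]. *)
Definition prob_rgg_tree (R : realType) (s d h : nat) (r : R) : \bar R :=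
  unif_prob [set x : 'I_(ntree s h) * 'I_d -> R |
    contains_copy (@bal_tree_vertex s h) (@bal_tree_edge s)
      (rgg_adj r (fun i k => x (i, k)))].

Definition rstar (R : realType) (d h : nat) : R :=
  Num.sqrt (d%:R) / (2 * h%:R).

(* Main.v *)
Require Import Defs.
From HB Require Import structures.
From mathcomp Require Import all_boot all_order all_algebra zify ring lra.
Set Implicit Arguments. Unset Strict Implicit. Unset Printing Implicit Defensive.
Import Order.TTheory GRing.Theory Num.Theory.

(** Below the threshold: with high probability there are points next to two
    opposite corners of the cube. All n points are images of tree vertices, and
    two tree vertices are joined by a path of at most 2h edges; by Cauchy-Schwarz
    an edge changes the sum of the coordinates by at most sqrt d * r, so 2h edges
    cannot cover the difference d - o(1) between the two corners.

    Above the threshold: divide the cube into K = m^d cells, m = O(h), ordered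
    along a snake. By Chebyshev, with high probability the number of points in
    the first t cells is n t / K up to n / (2K), for all t. On the tree side, each
    vertex of level e, a small fraction of h, gets a target cell, evenly distributed; the tree stays
    in the central cell up to level e, its branches walk to their targets in the
    next L = h - 2e levels, and all later levels, which contain almost all vertices,
    stay there. So the first t cells also receive n t / K vertices up to n / (2K).
    Matching vertices to points by rank along the snake moves every vertex by at
    most one cell, hence edges remain short and every point is used. *)

(** * Snake order and rank matching *)

(* Boustrophedon enumeration of the grid {0, ..., m-1}^d: consecutive cells
   differ by at most one in every coordinate, and [snake m d t k] is the k-th
   coordinate of the t-th cell. *)
Fixpoint snake (m d t k : nat) : nat :=
  if d is d'.+1 then
    let q := t %/ m ^ d' in let r := t %% m ^ d' in
    if k == d' then q
    else snake m d' (if odd q then m ^ d' - r.+1 else r) k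
  else 0.

Lemma snake_lt m d t k : 0 < m -> t < m ^ d -> k < d -> snake m d t k < m.
Proof.
move=> m0; elim: d t k => [//|d IH] t k lt_t; rewrite ltnS /= => le_k.
have md0 : 0 < m ^ d by rewrite expn_gt0 m0.
case: eqVneq => [_|ne]; first by rewrite ltn_divLR // -expnS.
apply: IH; last by lia.
have := ltn_pmod t md0; case: odd => //; lia.
Qed.

(** Inside a block of [m ^ d'] cells the top coordinate is fixed and the inner index moves by one,
    forwards or backwards. Between blocks the reversal on odd [q] gives both cells the same inner
    index, so only the top coordinate changes. *)
Lemma snake_step m d t k : t.+1 < m ^ d ->
  snake m d t k <= (snake m d t.+1 k).+1 /\
  snake m d t.+1 k <= (snake m d t k).+1.
Proof.
elim: d t k => [|d IH] t k lt_t /=; first by split.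
set M := m ^ d.
have M0 : 0 < M by rewrite expn_gt0; case: m lt_t @M {IH} => //; rewrite exp0n.
have [dv | /eqP ndv] := eqVneq (t.+1 %% M) 0; last first.
  have ltM : (t %% M).+1 < M.
    have := ltn_pmod t M0; rewrite leq_eqVlt => /orP[/eqP E|//].
    by move: ndv; rewrite -[t.+1]addn1 -modnDml addn1 E modnn.
  have Eq : t.+1 %/ M = t %/ M.
    by rewrite {1}(divn_eq t M) -addnS divnMDl // (divn_small ltM) addn0.
  have Er : t.+1 %% M = (t %% M).+1 by rewrite -[t.+1]addn1 -modnDml addn1 modn_small.
  rewrite Eq Er; case: eqVneq => // _; case: odd; last exact: IH.
  have -> : M - (t %% M).+1 = (M - (t %% M).+2).+1 by lia.
  by have [] := IH (M - (t %% M).+2) k; first rewrite -/M; lia.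
have Er : (t %% M).+1 = M.
  have := ltn_pmod t M0; rewrite leq_eqVlt => /orP[/eqP //|ltM].
  by move: dv; rewrite -[t.+1]addn1 -modnDml addn1 modn_small.
have Eq : t.+1 %/ M = (t %/ M).+1.
  by rewrite {1}(divn_eq t M) -addnS Er -mulSnr mulnK.
rewrite Eq dv; case: eqVneq => [_|_]; first by lia.
have E0 : t %% M = M.-1 by lia.
rewrite /= E0; case: odd => /=; last by rewrite subn1; lia.
have -> : M - M.-1.+1 = 0 by lia.
by lia.
Qed.

Lemma snake_inj m d t u : t < m ^ d -> u < m ^ d ->
  (forall k, k < d -> snake m d t k = snake m d u k) -> t = u.
Proof.
elim: d t u => [|d IH] t u lt_t lt_u E; first by move: lt_t lt_u; rewrite expn0; lia.
have M0 : 0 < m ^ d by rewrite expn_gt0; case: m lt_t {E IH lt_u} => //; rewrite exp0n.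
have Eq : t %/ m ^ d = u %/ m ^ d by move: (E d (ltnSn d)); rewrite /= eqxx.
have rt := ltn_pmod t M0; have ru := ltn_pmod u M0.
suff Er : t %% m ^ d = u %% m ^ d by rewrite (divn_eq t (m ^ d)) Eq Er -divn_eq.
have H : forall k, k < d -> snake m d (if odd (u %/ m ^ d) then m ^ d - (t %% m ^ d).+1 else t %% m ^ d) k = snake m d (if odd (u %/ m ^ d) then m ^ d - (u %% m ^ d).+1 else u %% m ^ d) k.
  move=> k lt_k; have := E k (ltnW lt_k); rewrite /= Eq.
  by case: eqVneq => // Ek; move: lt_k; rewrite Ek ltnn.
move: H; case: odd => H; last exact: IH.
by have := IH (m ^ d - (t %% m ^ d).+1) (m ^ d - (u %% m ^ d).+1) _ _ H; lia.
Qed.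

(** In a sorted list the entries below [t] form a prefix. *)
Lemma sorted_nth_lt_count (s : seq nat) k t : sorted leq s -> k < size s ->
  (nth 0 s k < t) = (k < count (fun x => x < t) s).
Proof.
elim: s k => [//|x s IH] k /= ps.
have all_ge : all (leq x) s by apply: order_path_min ps; exact: leq_trans.
case: k => [_|k]; rewrite /=.
  case: ltnP => // le; apply/esym; apply/negbTE; rewrite -leqNgt add0n leqn0.
  rewrite -[_ == 0]negbK -lt0n -has_count; apply/hasPn => y ys.
  by rewrite -leqNgt (leq_trans le) // (allP all_ge).
rewrite ltnS => ks; rewrite IH // ?(path_sorted ps) //.
case: (ltnP x t) => [//|le].
have E0 : count (fun x => x < t) s = 0.
  apply/eqP; rewrite -[_ == 0]negbK -lt0n -has_count; apply/hasPn => y ys.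
  by rewrite -leqNgt (leq_trans le) // (allP all_ge).
by rewrite E0.
Qed.

(* Sort both sides and match equal ranks. *)
Lemma monotone_matching (V W : finType) (f : V -> nat) (g : W -> nat) :
  #|V| = #|W| ->
  (forall t, #|[set v | f v < t]| <= #|[set w | g w < t.+1]|) ->
  (forall t, #|[set w | g w < t]| <= #|[set v | f v < t.+1]|) ->
  exists2 p : V -> W, injective p &
    forall v, f v <= (g (p v)).+1 /\ g (p v) <= (f v).+1.
Proof.
move=> cVW fg gf.
have [//|nV] := posnP #|V|.
  move=> V0; have noV : forall v : V, False.
    by move=> v; have := fintype0 v V0.
  by exists (fun v => match noV v with end) => v; case: (noV v).
have /card_gt0P[w0 _] : 0 < #|W| by rewrite -cVW.
have /card_gt0P[v0 _] : 0 < #|V| by [].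
pose lef u v := f u <= f v; pose leg u v := g u <= g v.
pose sV := sort lef (enum V); pose sW := sort leg (enum W).
have szV : size sV = #|V| by rewrite size_sort -cardE.
have szW : size sW = #|V| by rewrite size_sort -cardE cVW.
have mV v : v \in sV by rewrite mem_sort mem_enum.
have cnt (U : finType) (e : U -> nat) t :
    count (fun x => x < t) (map e (sort (relpre e leq) (enum U))) = #|[set u | e u < t]|.
  rewrite count_map cardE -size_filter; apply: perm_size.
  apply: uniq_perm; rewrite ?enum_uniq ?filter_uniq ?sort_uniq ?enum_uniq // => u.
  rewrite [RHS]mem_enum [RHS]inE [LHS]mem_filter [in LHS]mem_sort [X in _ && X]mem_enum.
  by rewrite andbT.
have srt (U : finType) (e : U -> nat) :
    sorted leq (map e (sort (relpre e leq) (enum U))).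
  by rewrite sorted_map; apply: sort_sorted => x y; exact: leq_total.
exists (fun v => nth w0 sW (index v sV)) => [u v|v].
  move/eqP; rewrite nth_uniq ?szW -?szV ?index_mem // ?sort_uniq ?enum_uniq //.
  by move/eqP/(congr1 (nth v0 sV)); rewrite !nth_index.
set k := index v sV.
have kV : k < #|V| by rewrite -szV index_mem.
(* An element of rank [k] lies below [t] iff more than [k] elements do. As [v] and its partner share
   the rank [k], the hypotheses on counts compare their values. *)
have Ef t : (f v < t) = (k < #|[set v | f v < t]|).
  rewrite -cnt -sorted_nth_lt_count ?srt ?size_map ?szV //.
  by rewrite (nth_map v0) ?szV // nth_index.
have Eg t : (g (nth w0 sW k) < t) = (k < #|[set w | g w < t]|).
  rewrite -cnt -sorted_nth_lt_count ?srt ?size_map ?szW //.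
  by rewrite (nth_map w0) ?szW.
split; rewrite -ltnS.
  by rewrite Ef (leq_trans _ (gf _)) // -Eg.
by rewrite Eg (leq_trans _ (fg _)) // -Ef.
Qed.

(** * Routing the tree through the grid *)

Lemma card_ord_lt n x : #|[set i : 'I_n | i < x]| = minn n x.
Proof.
have -> : #|[set i : 'I_n | i < x]| = \sum_(i < n | i < x) 1.
  by rewrite -sum1_card; apply: eq_bigl => i; rewrite inE.
rewrite minnC -[RHS]muln1 -[minn x n]card_ord -sum_nat_const.
rewrite -(big_mkord (fun i => i < x) (fun _ => 1)) -(big_mkord xpredT (fun _ => 1)).
have [le|lt] := leqP x n.
  by rewrite (big_nat_widen _ _ _ _ _ le); apply: eq_bigl => i; rewrite andTb.
by apply: congr_big_nat => // i /andP[_ lti]; rewrite (ltn_trans lti lt).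
Qed.

Section Snake.
Variables (m' d : nat).
Local Notation m := m'.+1.
Local Notation cell := {ffun 'I_d -> 'I_m}.

Definition snake_cell (t : nat) : cell := [ffun k : 'I_d => inord (snake m d t k)].

Lemma snake_cellE t k : t < m ^ d -> snake_cell t k = snake m d t k :> nat.
Proof. by move=> lt_t; rewrite ffunE inordK // snake_lt. Qed.

Lemma snake_cell_inj t u : t < m ^ d -> u < m ^ d -> snake_cell t = snake_cell u -> t = u.
Proof.
move=> lt_t lt_u E; apply: (@snake_inj m d) => // k lt_k.
by rewrite -(snake_cellE (Ordinal lt_k) lt_t) E snake_cellE.
Qed.

Lemma snake_cell_bij : bijective (fun t : 'I_(m ^ d) => snake_cell t).
Proof.
apply: inj_card_bij => [t u /snake_cell_inj E|]; first by apply: val_inj; exact: E.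
by rewrite card_ffun !card_ord.
Qed.

(** The inverse of [snake_cell]; by bijectivity the default 0 is never taken. *)
Definition snake_index (c : cell) : nat :=
  if [pick t : 'I_(m ^ d) | snake_cell t == c] is Some t then t else 0.

Lemma snake_indexP c : snake_index c < m ^ d /\ snake_cell (snake_index c) = c.
Proof.
rewrite /snake_index; case: pickP => [t /eqP //|none].
case: snake_cell_bij => f _ fK.
by have := none (f c); rewrite fK eqxx.
Qed.

Lemma snake_index_lt c : snake_index c < m ^ d.
Proof. by case: (snake_indexP c). Qed.

Lemma snake_indexK t : t < m ^ d -> snake_index (snake_cell t) = t.
Proof. by move=> lt_t; have [lt_i] := snake_indexP (snake_cell t); exact: snake_cell_inj. Qed.

Lemma card_snake_index_lt t : t <= m ^ d -> #|[set c | snake_index c < t]| = t.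
Proof.
move=> le_t; rewrite -[RHS](minn_idPr le_t) -card_ord_lt.
rewrite -(card_in_imset (f := fun t : 'I_(m ^ d) => snake_cell t)); last first.
  by move=> u v _ _ /snake_cell_inj E; apply: val_inj; exact: E.
congr #|pred_of_set _|; apply/setP => c; rewrite inE; apply/idP/imsetP => [lt_c|].
  have [lt_i E] := snake_indexP c.
  by exists (Ordinal lt_i); rewrite ?inE.
by case=> u; rewrite inE => lt_u ->; rewrite snake_indexK.
Qed.

(** Turns the matching error of one rank along the snake into an error of one cell per
    coordinate. *)
Lemma snake_index_close c c' k :
  snake_index c <= (snake_index c').+1 -> snake_index c' <= (snake_index c).+1 ->
  c k <= (c' k).+1 /\ c' k <= (c k).+1.
Proof.
have [lt_c Ec] := snake_indexP c; have [lt_c' Ec'] := snake_indexP c'.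
move=> h1 h2; rewrite -[in c k]Ec -[in c' k]Ec' !snake_cellE //.
have [E|[E|E]] : snake_index c = snake_index c' \/ snake_index c = (snake_index c').+1
    \/ snake_index c' = (snake_index c).+1 by lia.
- by rewrite E.
- by move: lt_c; rewrite E => /(@snake_step m d _ k)[].
- by move: lt_c'; rewrite E => /(@snake_step m d _ k)[].
Qed.

End Snake.

(* The descendant of rank [v] in level [l] heads for the same cell as its
   ancestor in level [i0]; the s^i0 vertices of that level are split into K
   blocks of consecutive ranks. *)
Definition target (K s i0 l v : nat) : nat := ((v %/ s ^ (l - i0)) * K) %/ s ^ i0.

Lemma target_lt K s i0 l v : 0 < K -> 0 < s -> i0 <= l -> v < s ^ l ->
  target K s i0 l v < K.
Proof.
move=> K0 s0 le_l lt_v; rewrite /target ltn_divLR ?expn_gt0 ?s0 // mulnC ltn_pmul2l //.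
by rewrite ltn_divLR ?expn_gt0 ?s0 // -expnD subnKC.
Qed.

(** [target < t] says that the block of [s ^ (l - i0)] ranks containing [v] starts below
    [t * s ^ l / K]. So the set is a prefix of that length up to one block, and the factor 2 absorbs
    the rounding. *)
Lemma target_count K s i0 l t : 0 < K -> 0 < s -> i0 <= l -> t <= K ->
  let c := #|[set v : 'I_(s ^ l) | target K s i0 l v < t]| in
  t * s ^ l <= K * c /\ K * c <= t * s ^ l + 2 * K * s ^ (l - i0).
Proof.
move=> K0 s0 le_l le_t c.
set M := s ^ (l - i0); set N := s ^ i0.
have M0 : 0 < M by rewrite expn_gt0 s0.
have N0 : 0 < N by rewrite expn_gt0 s0.
have El : s ^ l = N * M by rewrite -expnD subnKC.
have tE v : (target K s i0 l v < t) = (v %/ M * K < t * N) by rewrite /target ltn_divLR.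
pose Y := t * (N * M).
have divY := divn_eq Y K; have modY := ltn_pmod Y K0.
split.
  (* The ceiling of [Y / K]: if [v * K < Y], then the start of the block of [v] also qualifies. *)
  pose x := (Y + K.-1) %/ K.
  have divx := divn_eq (Y + K.-1) K; have modx := ltn_pmod (Y + K.-1) K0.
  have xle : x <= s ^ l.
    by rewrite -ltnS /x ltn_divLR // El /Y; nia.
  have sub : [set v : 'I_(s ^ l) | v < x] \subset [set v : 'I_(s ^ l) | target K s i0 l v < t].
    apply/subsetP => v; rewrite !inE tE => vx.
    have vY : v * K < Y by rewrite -/x in divx; nia.
    rewrite -(ltn_pmul2r M0) -[X in _ < X]mulnA -/Y.
    apply: leq_ltn_trans vY; rewrite mulnAC leq_pmul2r //; exact: leq_divM.
  have := subset_leq_card sub; rewrite card_ord_lt -/c (minn_idPr xle) El -/Y => le_c.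
  rewrite -/x in divx; nia.
(* A counted block starts below [Y / K] and has length [M]. *)
pose x := Y %/ K + M + 1.
have sub : [set v : 'I_(s ^ l) | target K s i0 l v < t] \subset [set v : 'I_(s ^ l) | v < x].
  apply/subsetP => v; rewrite !inE tE => vt.
  have dv := divn_eq v M; have mv := ltn_pmod v M0.
  have lt1 : v %/ M * K * M < Y by rewrite /Y mulnA ltn_pmul2r.
  rewrite /x; nia.
have := subset_leq_card sub; rewrite -/c card_ord_lt => le_c.
have {}le_c : c <= x by apply: leq_trans le_c (geq_minr _ _).
rewrite El -/Y; move: le_c; rewrite /x; nia.
Qed.

(* Position after [t] steps of length at most [D] when walking from [M0]
   towards [c]; the truncated subtraction is harmless since [c >= 0]. *)
Definition clamp (M0 D c t : nat) : nat := maxn (minn c (M0 + D * t)) (M0 - D * t).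

(** The word read in base [s], that is, its lexicographic rank within its level; dividing by [s]
    gives the rank of the parent. *)
Definition word_rank s (w : seq 'I_s) : nat := foldl (fun x (a : 'I_s) => x * s + a) 0 w.

Lemma word_rank_rcons s (w : seq 'I_s) a : word_rank (rcons w a) = word_rank w * s + a.
Proof. exact: foldl_rcons. Qed.

Lemma word_rank_lt s (w : seq 'I_s) : word_rank w < s ^ size w.
Proof.
elim/last_ind: w => [|w a IH]; first by rewrite expn0.
by rewrite word_rank_rcons size_rcons expnSr; have := ltn_ord a; nia.
Qed.

Lemma word_rank_inj s (u v : seq 'I_s) : size u = size v -> word_rank u = word_rank v -> u = v.
Proof.
elim/last_ind: u v => [|u a IH] v; first by case: v.
case/lastP: v => [|v b]; rewrite !size_rcons // => -[sz].
rewrite !word_rank_rcons => E.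
have s0 : 0 < s by case: s a {IH b E u v sz} => [[]|].
have Ea : a = b :> nat.
  by have := congr1 (fun x => x %% s) E; rewrite /= !modnMDl !modn_small.
have /IH -> // : word_rank u = word_rank v.
  by have := congr1 (fun x => x %/ s) E; rewrite /= !divnMDl // !divn_small // !addn0.
by congr rcons; exact: val_inj.
Qed.

Lemma sum_expn_le s j : 1 < s -> \sum_(i < j) s ^ i <= s ^ j.
Proof.
move=> s1; elim: j => [|j IH]; first by rewrite big_ord0.
rewrite big_ord_recr /= expnS (leq_trans (leq_add IH (leqnn _))) //.
by rewrite addnn -mul2n leq_mul2r s1 orbT.
Qed.

Section TreeEmbedding.
Variables (s d D L e m' : nat).
Hypothesis s_gt1 : 1 < s.
Hypothesis mE : m'.+1 = 2 * D * L.
Local Notation m := m'.+1.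
Local Notation K := (m ^ d).
Local Notation cell := {ffun 'I_d -> 'I_m}.
Hypothesis K_small : 8 * K <= s ^ e.
Local Notation h := (L + 2 * e).
Local Notation n := (\sum_(i < h.+1) s ^ i).

(** The walk starts at the centre [D * L] of a grid of side [2 * D * L]. Truncation of [l - e] keeps
    it there up to level [e]. *)
Definition place_coord (k : 'I_d) (l v : nat) : nat :=
  clamp (D * L) D (snake_cell m' d (target K s e l v) k) (l - e).

Definition place (l v : nat) : cell := [ffun k => inord (place_coord k l v)].

Lemma placeE k l v : place l v k = place_coord k l v :> nat.
Proof.
rewrite ffunE inordK // /place_coord /clamp.
have := ltn_ord (snake_cell m' d (target K s e l v) k); lia.
Qed.

Lemma place_root k l v : l <= e -> place l v k = D * L :> nat.
Proof. by move=> le_l; rewrite placeE /place_coord /clamp (eqP le_l) muln0; lia. Qed.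

(** No coordinate is farther than [D * L] from the centre, so [L] steps of length [D] suffice. *)
Lemma place_final l v : e + L <= l -> place l v = snake_cell m' d (target K s e l v).
Proof.
move=> le_l; apply/ffunP => k; apply: ord_inj; rewrite placeE /place_coord /clamp.
have := ltn_ord (snake_cell m' d (target K s e l v) k).
have : D * L <= D * (l - e) by rewrite leq_mul2l; lia.
have : m = 2 * (D * L) by rewrite mulnA.
by set c := nat_of_ord _; set x := D * (l - e); set y := D * L; lia.
Qed.

(** Above level [e] both ends sit at the centre; from level [e] on, parent and child share their
    target and the walk advances by one step. *)
Lemma place_step k l v a : a < s ->
  place l v k <= place l.+1 (v * s + a) k + D /\
  place l.+1 (v * s + a) k <= place l v k + D.
Proof.
move=> lt_a; have [le_l|lt_l] := leqP e l; last first.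
  by rewrite !place_root ?(ltnW lt_l) //; lia.
rewrite !placeE /place_coord.
have -> : target K s e l.+1 (v * s + a) = target K s e l v.
  have s0 : 0 < s by apply: ltnW.
  by rewrite /target subSn // expnS divnMA divnMDl // (divn_small lt_a) addn0.
by rewrite /clamp subSn // mulnS; set x := D * (l - e); set y := D * L; lia.
Qed.

Lemma level_count l t : t <= K ->
  let c := #|[set v : 'I_(s ^ l) | snake_index (place l v) < t]| in
  let err := if l < e + L then K * s ^ l else 2 * K * s ^ (l - e) in
  t * s ^ l <= K * c + err /\ K * c <= t * s ^ l + err.
Proof.
move=> le_t c; case: ltnP => [lt_l|le_l] /=.
  have : c <= s ^ l by rewrite -[leqRHS]card_ord max_card.
  by move: le_t; nia.
have K0 : 0 < K by rewrite expn_gt0.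
have le_e : e <= l by lia.
have [] := @target_count K s e l t K0 (ltnW s_gt1) le_e le_t.
have -> : [set v : 'I_(s ^ l) | target K s e l v < t] = [set v : 'I_(s ^ l) | snake_index (place l v) < t].
  apply/setP => v; rewrite !inE place_final // snake_indexK //.
  by apply: target_lt => //; lia.
by rewrite -/c; lia.
Qed.

Local Notation vertex := {l : 'I_h.+1 & 'I_(s ^ l)}.

Definition vertex_index (x : vertex) : nat := snake_index (place (tag x) (tagged x)).

Lemma card_vertex : #|{: vertex}| = n.
Proof. by rewrite card_tagged sumnE big_map big_enum; apply: eq_bigr => l _; rewrite card_ord. Qed.

(* Levels below [e + L] hold few vertices; in each later level the targets are
   spread over the cells up to one block of s^(l-e) consecutive ranks. *)
Lemma vertex_count t : t <= K ->
  let A := #|[set x : vertex | vertex_index x < t]| in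
  2 * t * n <= 2 * K * A + n /\ 2 * K * A <= 2 * t * n + n.
Proof.
move=> le_t A.
pose c l := #|[set v : 'I_(s ^ l) | snake_index (place l v) < t]|.
pose err l := if l < e + L then K * s ^ l else 2 * K * s ^ (l - e).
have EA : A = \sum_(l < h.+1) c l.
  rewrite /A -sum1_card.
  under eq_bigl => x do rewrite inE /vertex_index.
  rewrite -(@sig_big_dep _ _ _ _ (fun l : 'I_h.+1 => 'I_(s ^ l)) xpredT
    (fun l v => snake_index (place l v) < t) (fun _ _ => 1)).
  by apply: eq_bigr => l _; rewrite /c -sum1_card; apply: eq_bigl => v; rewrite inE.
have err_le : 2 * \sum_(l < h.+1) err l <= n.
  (* By [8 * K <= s ^ e], a late level has [4 * err l <= s ^ l], and the early levels together cost
     at most [4 * K * s ^ (e + L) <= s ^ h]. The total is at most [n + s ^ h <= 2 * n]. *)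
  have le1 l : l < h.+1 -> 4 * err l <= s ^ l + (if l < e + L then 4 * K * s ^ l else 0).
    move=> lt_l; rewrite /err; case: ltnP => [_|le_l]; first by lia.
    by rewrite addn0 -{2}(subnK (leq_trans (leq_addr _ _) le_l)) expnD; nia.
  have le2 : \sum_(l < h.+1) (if l < e + L then 4 * K * s ^ l else 0) <= s ^ h.
    rewrite -big_mkcond /= -(big_ord_widen_cond h.+1 xpredT (fun l => 4 * K * s ^ l)); last by lia.
    rewrite -big_distrr /= (leq_trans (leq_mul (leqnn _) (sum_expn_le _ s_gt1))) //.
    have -> : h = e + (e + L) by lia.
    by rewrite [s ^ (e + (e + L))]expnD leq_mul2r; lia.
  have le3 : s ^ h <= n by rewrite big_ord_recr /= leq_addl.
  have : 4 * \sum_(l < h.+1) err l <= n + s ^ h.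
    rewrite big_distrr /= (leq_trans _ (leq_add (leqnn _) le2)) // -big_split /=.
    by apply: leq_sum => l _; apply: le1.
  by move: le3; lia.
have b1 : t * n <= K * A + \sum_(l < h.+1) err l.
  rewrite EA !big_distrr -big_split /=; apply: leq_sum => l _.
  by have [] := level_count l le_t.
have b2 : K * A <= t * n + \sum_(l < h.+1) err l.
  rewrite EA !big_distrr -big_split /=; apply: leq_sum => l _.
  by have [] := level_count l le_t.
by rewrite -!mulnA; lia.
Qed.

(** In [D + 2], the walk contributes [D] and the matching contributes one cell at each end of the
    edge. *)
Lemma tree_embedding (g : 'I_n -> cell) :
  (forall t, t < K -> let B := #|[set i | snake_index (g i) < t]| in
    2 * t * n <= 2 * K * B + n /\ 2 * K * B <= 2 * t * n + n) ->
  exists phi : seq 'I_s -> 'I_n,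
    (forall u v, size u <= h -> size v <= h -> phi u = phi v -> u = v) /\
    (forall u a (k : 'I_d), size u < h ->
       g (phi u) k <= g (phi (rcons u a)) k + (D + 2) /\
       g (phi (rcons u a)) k <= g (phi u) k + (D + 2)).
Proof.
move=> balanced.
have K0 : 0 < K by rewrite expn_gt0.
(* The two errors of [n / (2K)] add up to [n / K], the expected content of one cell, so a shift of
   [t] by one absorbs them. *)
have cmp t x y : 2 * K * x <= 2 * t * n + n -> 2 * t.+1 * n <= 2 * K * y + n -> x <= y.
  have K2 : 0 < 2 * K by rewrite muln_gt0.
  rewrite mulnS mulnDl -[x <= y](leq_pmul2l K2).
  by set N := \sum_(_ < _) _; set X := 2 * K * x; set Y := 2 * K * y; set Z := 2 * t * N; lia.
have full (U : finType) (f : U -> nat) t : (forall x, f x < K) -> K <= t ->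
    #|[set x | f x < t]| = #|U|.
  move=> lt_f le_t; rewrite -cardsT; congr #|pred_of_set _|.
  by apply/setP => x; rewrite !inE (leq_trans (lt_f x)).
have fltK x : vertex_index x < K by apply: snake_index_lt.
have gltK i : snake_index (g i) < K by apply: snake_index_lt.
have [] := @monotone_matching vertex 'I_n vertex_index (fun i => snake_index (g i)).
- by rewrite card_vertex card_ord.
- move=> t; have [le|lt] := leqP K t.+1.
    by rewrite [leqRHS]full // card_ord -card_vertex max_card.
  have [_ H1] := vertex_count (ltnW (ltnW lt)); have [H2 _] := balanced _ lt.
  exact: cmp H1 H2.
- move=> t; have [le|lt] := leqP K t.+1.
    by rewrite [leqRHS]full // card_vertex -[leqRHS]card_ord max_card.
  have [H1 _] := vertex_count (ltnW lt); have [_ H2] := balanced _ (ltnW lt).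
  exact: cmp H2 H1.
move=> p p_inj p_close.
pose vtx w (H : size w < h.+1) : vertex :=
  Tagged (fun l : 'I_h.+1 => 'I_(s ^ l)) (i := Ordinal H) (Ordinal (word_rank_lt w)).
(* Words longer than [h] receive the image of the root as a default. *)
pose phi w := if decP (@idP (size w < h.+1)) is left H then p (vtx w H) else p (vtx [::] isT).
have phiE w (H : size w < h.+1) : phi w = p (vtx w H).
  rewrite /phi; case: decP => [H'|//].
  by rewrite (bool_irrelevance H' H).
exists phi; split=> [u v Hu Hv|u a k lt_u].
  rewrite (phiE _ Hu) (phiE _ Hv) => /p_inj E.
  by apply: word_rank_inj;
    [have := congr1 (fun x : vertex => tag x : nat) E
    |have := congr1 (fun x : vertex => tagged x : nat) E].
have Hu : size u < h.+1 by apply: ltnW.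
have Ha : size (rcons u a) < h.+1 by rewrite size_rcons.
rewrite (phiE _ Hu) (phiE _ Ha).
have [] := p_close (vtx u Hu); have [] := p_close (vtx _ Ha).
rewrite /vertex_index /= size_rcons word_rank_rcons => c1 c2 c3 c4.
have [] := snake_index_close k c1 c2; have [] := snake_index_close k c3 c4.
have [] := place_step k (size u) (word_rank u) (ltn_ord a).
lia.
Qed.

End TreeEmbedding.

Local Open Scope ring_scope.

(** * Second moment *)

(** Independence of distinct coordinates: by distributivity the sum factorises over coordinates, and
    the factor at [i] is the sum of [Z]. *)
Lemma sum_ffun_prod2 (R : comNzRingType) (J : finType) n (Z : J -> R) (i i' : 'I_n) :
  \sum_j Z j = 0 -> i != i' -> \sum_(y : {ffun 'I_n -> J}) Z (y i) * Z (y i') = 0.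
Proof.
move=> Z0 ne.
pose F l j := if (l == i) || (l == i') then Z j else 1.
have E (y : {ffun 'I_n -> J}) : Z (y i) * Z (y i') = \prod_l F l (y l).
  rewrite (bigD1 i) //= (bigD1 i') 1?eq_sym //= /F !eqxx orbT big1 ?mulr1 //.
  by move=> l /andP[/negbTE -> /negbTE ->].
under eq_bigr => y _ do rewrite E.
rewrite -(bigA_distr_bigA F) (bigD1 i) //= /F eqxx /=.
by rewrite Z0 mul0r.
Qed.

(** The variance of a sum of independent centred terms: only the [n] diagonal terms survive. *)
Lemma sum_ffun_sqr (J : finType) n (Z : J -> int) (C : int) :
  \sum_j Z j = 0 -> (forall j, Z j ^+ 2 <= C) ->
  \sum_(y : {ffun 'I_n -> J}) (\sum_i Z (y i)) ^+ 2 <= n%:R * C * (#|J| ^ n)%:R.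
Proof.
move=> Z0 ZC.
under eq_bigr => y _ do rewrite expr2 big_distrlr /=.
rewrite exchange_big /=.
have -> : n%:R * C * (#|J| ^ n)%:R = \sum_(i < n) C * (#|J| ^ n)%:R.
  by rewrite sumr_const card_ord -[RHS]mulr_natl mulrA.
apply: ler_sum => i _; rewrite exchange_big /= (bigD1 i) //= [X in _ + X]big1 ?addr0; last first.
  by move=> i' ne; apply: sum_ffun_prod2; rewrite // eq_sym.
have -> : C * (#|J| ^ n)%:R = \sum_(y : {ffun 'I_n -> J}) C.
  by rewrite sumr_const card_ffun card_ord -[RHS]mulr_natr.
by apply: ler_sum => y _; rewrite -expr2.
Qed.

(** The count [B] is within [n / (2 |J|)] of its mean [n |S| / |J|], with denominators cleared. *)
Definition balanced (J : finType) (S : {set J}) n (y : 'I_n -> J) : bool :=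
  let B := #|[set i | y i \in S]| in
  ((2 * #|S| * n <= 2 * #|J| * B + n) && (2 * #|J| * B <= 2 * #|S| * n + n))%N.

Lemma card_unbalanced (J : finType) (S : {set J}) n :
  (#|[set y : {ffun 'I_n -> J} | ~~ balanced S y]| * n <= 4 * #|J| ^ 2 * #|J| ^ n)%N.
Proof.
have [->|n0] := posnP n; first by rewrite muln0.
(* Chebyshev: Z is the centred indicator of S, scaled by |J| to stay integral. *)
pose Z j : int := #|J|%:R * (j \in S)%:R - #|S|%:R.
have sumS (I : finType) (P : pred I) : \sum_i (P i)%:R = #|[set i | P i]|%:R :> int.
  by rewrite -natr_sum -sum1_card; congr (_%:R); rewrite [RHS]big_mkcond; apply: eq_bigr => i _; rewrite inE; case: (P i).
have Z0 : \sum_j Z j = 0.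
  rewrite big_split /= -big_distrr /= sumS sumr_const -[(- _) *+ _]mulr_natl.
  have -> : [set i | i \in S] = S by apply/setP => x; rewrite inE.
  by rewrite mulrN subrr.
have ZC j : Z j ^+ 2 <= (#|J| ^ 2)%:R.
  have le : (#|S| <= #|J|)%N by apply: max_card.
  by rewrite /Z natrX; case: (j \in S); rewrite ?mulr1 ?mulr0; nia.
have := sum_ffun_sqr n Z0 ZC.
set T := \sum_y _; set b := #|_| => le_T.
(* For an unbalanced [y] the sum of the [Z (y i)] exceeds [n / 2] in absolute value. *)
have lb : (n%:R ^+ 2) * b%:R <= 4 * T :> int.
  rewrite [leLHS]mulr_natr -sumr_const.
  rewrite /T [4 * _]big_distrr /= [leRHS](bigID (mem [set y : {ffun 'I_n -> J} | ~~ balanced S y])) /=.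
  rewrite -[leLHS]addr0; apply: lerD; last first.
    by apply: sumr_ge0 => y _; rewrite mulr_ge0 // sqr_ge0.
  apply: ler_sum => y; rewrite inE /balanced => unb.
  have -> : \sum_i Z (y i) = #|J|%:R * #|[set i | y i \in S]|%:R - #|S|%:R * n%:R.
    rewrite big_split /= -big_distrr /= sumS sumr_const card_ord.
    by rewrite -[(- _) *+ _]mulr_natr mulNr.
  move: unb; rewrite negb_and -!ltnNge.
  move: (#|J|) (#|S|) (#|[set i | _]|) => a c x /orP[]; nia.
have : (n * (b * n) <= n * (4 * #|J| ^ 2 * #|J| ^ n))%N by move: lb le_T; nia.
by rewrite leq_pmul2l.
Qed.

(** Passes from a family indexed by pairs (point, axis), as in the probability space, to one cell of
    the cube per point. *)
Definition curry_ffun (A B C : finType) (y : {ffun A * B -> C}) : {ffun A -> {ffun B -> C}} :=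
  [ffun a => [ffun b => y (a, b)]].

Lemma curry_ffun_bij (A B C : finType) : bijective (@curry_ffun A B C).
Proof.
exists (fun z : {ffun A -> {ffun B -> C}} => [ffun ab : A * B => z ab.1 ab.2]) => y; last first.
  by apply/ffunP => a; apply/ffunP => b; rewrite !ffunE.
by apply/ffunP => -[a b]; rewrite !ffunE.
Qed.

Lemma card_curry_ffun (A B C : finType) (P : pred {ffun A -> {ffun B -> C}}) :
  #|[set y : {ffun A * B -> C} | P (curry_ffun y)]| = #|[set z | P z]|.
Proof.
rewrite -(on_card_preimset (f := @curry_ffun A B C)); last first.
  by apply: onW_bij; apply: curry_ffun_bij.
by congr #|pred_of_set _|; apply/setP => y; rewrite !inE.
Qed.

From mathcomp Require Import all_classical all_reals all_analysis measurable_realfun.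
Import numFieldNormedType.Exports.
Local Open Scope classical_set_scope.

(** * Discretisation of the uniform measure *)

(* Integrals of nonnegative functions are suprema over simple functions below,
   so no measurability is needed for monotonicity. *)
Lemma ge0_le_integral_nonmeas d (T : measurableType d) (R : realType)
    (mu : {measure set T -> \bar R}) (D : set T) (f g : T -> \bar R) :
  (forall x, D x -> 0%E <= f x)%E -> (forall x, D x -> f x <= g x)%E ->
  (\int[mu]_(x in D) f x <= \int[mu]_(x in D) g x)%E.
Proof.
move=> f0 fg.
have g0 x : D x -> (0 <= g x)%E by move=> Dx; apply: le_trans (f0 _ Dx) (fg _ Dx).
rewrite !ge0_integralE //; apply: le_ereal_sup => _ [u uf <-] /=.
exists u => // x; apply: le_trans (uf x) _.
by rewrite /patch; case: ifPn => // /set_mem; apply: fg.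
Qed.

Definition cube (R : realType) (I : Type) (x : I -> R) : Prop := forall i, 0 <= x i <= 1.

(** Nonnegativity is carried through the induction because comparing the outer integrals uses it for
    the inner ones. *)
Lemma iter_unif_int_mono (R : realType) (I : eqType) (cs : seq I) (f g : (I -> R) -> \bar R) x0 :
  cube x0 -> (forall x, cube x -> 0%E <= f x)%E -> (forall x, cube x -> f x <= g x)%E ->
  (0%E <= iter_unif_int cs f x0 <= iter_unif_int cs g x0)%E.
Proof.
move=> + f0 fg; elim: cs x0 => [|i cs IH] x0 c0 /=; first by rewrite f0 //= fg.
have c1 t : `[0%R, 1%R]%classic t -> cube (fun j => if j == i then t else x0 j).
  by rewrite /= in_itv /= => t01 j; case: ifP.
apply/andP; split.
  by apply: integral_ge0 => t /c1 /IH /andP[].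
by apply: ge0_le_integral_nonmeas => t /c1 /IH /andP[].
Qed.

(* The last cell is closed, so that the cells partition [0, 1]. *)
Definition cell_of (R : realType) (m' : nat) (x : R) : 'I_m'.+1 :=
  inord (minn m' (Num.trunc (m'.+1%:R * x))).

Lemma cell_ofP (R : realType) m' (x : R) : 0 <= x <= 1 ->
  let a : nat := cell_of m' x in a%:R <= m'.+1%:R * x <= a.+1%:R.
Proof.
move=> /andP[x0 x1]; rewrite /cell_of inordK ?ltnS ?geq_minl //=.
have y0 : 0 <= m'.+1%:R * x by rewrite mulr_ge0.
have y1 : m'.+1%:R * x <= m'.+1%:R by rewrite ler_piMr.
have /andP[t0 t1] := truncn_itv y0.
case: leqP => [le|lt]; last by rewrite t0 ltW.
by rewrite y1 andbT (le_trans _ t0) // ler_nat.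
Qed.

(** [BSide true] excludes the right endpoint, so only the last cell is closed there. *)
Definition cell_itv (R : realType) (m' a : nat) : interval R :=
  Interval (BLeft (a%:R / m'.+1%:R)) (BSide (a < m')%N (a.+1%:R / m'.+1%:R)).

Lemma cell_ofE (R : realType) m' (a : 'I_m'.+1) (x : R) : 0 <= x <= 1 ->
  (cell_of m' x == a) = (x \in cell_itv R m' a).
Proof.
move=> /andP[x0 x1].
have y0 : 0 <= m'.+1%:R * x by rewrite mulr_ge0.
have y1 : m'.+1%:R * x <= m'.+1%:R by rewrite ler_piMr.
rewrite -val_eqE /= /cell_of inordK ?ltnS ?geq_minl //.
have m0 : 0 < m'.+1%:R :> R by [].
rewrite /cell_itv in_itv /= ler_pdivrMr // [x * _]mulrC.
case: (ltnP a m') => [lt_a|le_a] /=.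
  rewrite ltr_pdivlMr // [x * _]mulrC -(truncn_eq a y0).
  by case: leqP => // le; apply/eqP/eqP; lia.
have -> : (a : nat) = m' by apply/eqP; rewrite eqn_leq le_a -ltnS ltn_ord.
by rewrite ler_pdivlMr // [x * _]mulrC y1 andbT -truncn_ge_nat // /minn; case: ltnP => [lt|le]; rewrite ?eqxx ?(ltnW lt) // eqn_leq le.
Qed.

Lemma cell_itv_sub01 (R : realType) m' (a : 'I_m'.+1) (x : R) :
  x \in cell_itv R m' a -> 0 <= x <= 1.
Proof.
have m0 : 0 < m'.+1%:R :> R by [].
have le1 : a.+1%:R / m'.+1%:R <= 1 :> R by rewrite ler_pdivrMr // mul1r ler_nat.
have ge0 : 0 <= a%:R / m'.+1%:R :> R by rewrite divr_ge0.
rewrite /cell_itv in_itv /= => /andP[h1]; rewrite (le_trans ge0 h1) /=.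
by case: ltnP => _ /= h2; [apply: ltW; apply: lt_le_trans le1 | apply: le_trans le1].
Qed.

Lemma lebesgue_cell_itv (R : realType) m' (a : 'I_m'.+1) :
  lebesgue_measure [set` cell_itv R m' a] = (m'.+1%:R^-1)%:E.
Proof.
rewrite lebesgue_measure_itv /= lte_fin ltr_pM2r ?invr_gt0 // ltr_nat ltnSn.
by rewrite -EFinB -mulrBl -natrB // subSnn mul1r.
Qed.

Lemma integral_cell_of (R : realType) m' (G : 'I_m'.+1 -> R) : (forall a, 0 <= G a) ->
  (\int[@lebesgue_measure R]_(t in `[0%R, 1%R]) (G (cell_of m' t))%:E =
   (m'.+1%:R^-1 * \sum_a G a)%:E)%E.
Proof.
move=> G0.
transitivity (\int[@lebesgue_measure R]_(t in `[0%R, 1%R])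
    \sum_(a < m'.+1) ((G a)%:E * (\1_[set` cell_itv R m' a] t)%:E))%E.
  apply: eq_integral => t; rewrite inE /= in_itv /= => t01.
  rewrite (bigD1 (cell_of m' t)) //= big1 ?adde0.
    by rewrite indicE mem_set ?mule1 //= -cell_ofE.
  by move=> a ne; rewrite indicE memNset ?mule0 //= -cell_ofE // eq_sym (negbTE ne).
have mI a : measurable_fun (`[0%R, 1%R]%classic : set R) (\1_[set` cell_itv R m' a] : R -> R).
  by apply: measurable_indic.
rewrite ge0_integral_sum //; last 2 first.
- by move=> a; apply: emeasurable_funM => //; apply/measurable_EFinP.
- by move=> a t _; rewrite mule_ge0 ?lee_fin.
rewrite mulr_sumr -sumEFin; apply: eq_bigr => a _.
rewrite ge0_integralZl_EFin // ?lee_fin //; last by apply/measurable_EFinP.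
rewrite integral_indic // setIidl; last first.
  by move=> t /= /cell_itv_sub01; rewrite in_itv.
rewrite [X in (_ * X)%E](_ : _ = (m'.+1%:R^-1)%:E); last exact: lebesgue_cell_itv.
by rewrite -EFinM mulrC.
Qed.

Definition cells (R : realType) (I : finType) m' (x : I -> R) : {ffun I -> 'I_m'.+1} :=
  [ffun i => cell_of m' (x i)].

(** Each integration averages over the cells of one coordinate; coordinates outside [cs] stay pinned
    to the cell of [x0]. *)
Lemma iter_unif_int_cells (R : realType) (I : finType) m' (F : {ffun I -> 'I_m'.+1} -> R)
    (cs : seq I) (x0 : I -> R) : (forall y, 0 <= F y) -> uniq cs ->
  iter_unif_int cs (fun x => (F (cells m' x))%:E) x0 =
  (m'.+1%:R ^- size cs *
    \sum_(y : {ffun I -> 'I_m'.+1} | [forall i, (i \in cs) || (y i == cell_of m' (x0 i))]) F y)%:E.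
Proof.
move=> F0; elim: cs x0 => [|i cs IH] x0 /=.
  move=> _; rewrite expr0 invr1 mul1r; congr EFin.
  rewrite (big_pred1 (cells m' x0)) // => y /=.
  apply/forallP/eqP => [H|-> i]; last by rewrite ffunE eqxx.
  by apply/ffunP => i; rewrite ffunE; apply/eqP/H.
move=> /andP[inc ucs].
pose G a := m'.+1%:R ^- size cs *
  \sum_(y : {ffun I -> 'I_m'.+1} | [forall j, (j \in i :: cs) || (y j == cell_of m' (x0 j))] && (y i == a)) F y.
transitivity (\int[@lebesgue_measure R]_(t in `[0%R, 1%R]) (G (cell_of m' t))%:E)%E.
  apply: eq_integral => t _; rewrite IH // /G; congr (_ * _)%:E.
  apply: eq_bigl => y; apply/forallP/andP => [H|[/forallP H /eqP Ei] j].
    split; last by have := H i; rewrite (negbTE inc) eqxx.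
    apply/forallP => j; rewrite in_cons; have := H j.
    by case: (eqVneq j i) => [->|ne] /=.
  have := H j; rewrite in_cons; case: eqVneq => [->|_] //= _.
  by rewrite Ei eqxx orbT.
rewrite integral_cell_of; last first.
  by move=> a; rewrite mulr_ge0 ?invr_ge0 ?exprn_ge0 // sumr_ge0.
congr EFin; rewrite /G -mulr_sumr mulrA -invfM -exprS; congr (_ * _).
by rewrite [RHS](partition_big (fun y : {ffun I -> 'I_m'.+1} => y i) xpredT).
Qed.

Lemma unif_prob_cells (R : realType) (I : finType) m' (A : {set {ffun I -> 'I_m'.+1}}) :
  iter_unif_int (enum I) (fun x : I -> R => ((cells m' x \in A)%:R)%:E) (fun _ => 0) =
  (#|A|%:R / m'.+1%:R ^+ #|I|)%:E.
Proof.
rewrite (@iter_unif_int_cells R I m' (fun y => (y \in A)%:R)) ?enum_uniq //.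
rewrite -cardE mulrC; congr (_ * _)%:E.
rewrite -sum1_card natr_sum [RHS]big_mkcond [LHS]big_mkcond /=; apply: eq_bigr => y _.
case: ifPn => [_|/forallPn[i]]; first by case: (y \in A).
by rewrite mem_enum.
Qed.

(** The indicator of [E] is dominated by that of a union of cells, whose iterated integral is a
    count. *)
Lemma unif_prob_le (R : realType) (I : finType) (E : set (I -> R)) m'
    (A : {set {ffun I -> 'I_m'.+1}}) :
  (forall x, cube x -> E x -> cells m' x \in A) ->
  (0 <= unif_prob E <= (#|A|%:R / m'.+1%:R ^+ #|I|)%:E)%E.
Proof.
move=> EA; rewrite -unif_prob_cells; apply: iter_unif_int_mono.
- by move=> i; rewrite lexx ler01.
- by move=> x _; rewrite lee_fin.
move=> x cx; rewrite lee_fin indicE ler_nat; have [/set_mem Ex|_ //] := boolP (x \in E).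
by rewrite EA.
Qed.

Lemma unif_prob_ge (R : realType) (I : finType) (E : set (I -> R)) m'
    (A : {set {ffun I -> 'I_m'.+1}}) :
  (forall x, cube x -> cells m' x \notin A -> E x) ->
  ((1 - #|A|%:R / m'.+1%:R ^+ #|I|)%:E <= unif_prob E <= 1)%E.
Proof.
move=> EA.
have M0 : 0 < m'.+1%:R ^+ #|I| :> R by rewrite exprn_gt0.
have cM : #|{: {ffun I -> 'I_m'.+1}}|%:R = m'.+1%:R ^+ #|I| :> R.
  by rewrite card_ffun card_ord natrX.
apply/andP; split; last first.
  have /andP[_] := @unif_prob_le R I E m' [set: _]%SET (fun x _ _ => finset.in_setT _).
  by rewrite cardsT cM divff ?gt_eqF.
have -> : 1 - #|A|%:R / m'.+1%:R ^+ #|I| = #|(~: A)%SET|%:R / m'.+1%:R ^+ #|I| :> R.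
  rewrite -[X in X - _](divff (lt0r_neq0 M0)) -mulrBl; congr (_ / _).
  by rewrite -cM -(cardsC A) natrD addrC addKr.
rewrite -unif_prob_cells.
apply: (fun h1 h2 h3 => proj2 (andP (@iter_unif_int_mono R I (enum I)
   (fun x => ((cells m' x \in (~: A)%SET)%:R)%:E) (fun x => (\1_E x)%:E) (fun _ => 0) h1 h2 h3))).
- by move=> i; rewrite lexx ler01.
- by move=> x _; rewrite lee_fin.
move=> x cx; rewrite lee_fin indicE ler_nat inE; have [//|nA] := boolP (cells m' x \in A).
by rewrite mem_set //; apply: EA.
Qed.

(** * Random geometric graphs *)

(** Union bound over [Q] of the Chebyshev estimate, with [m'.+1 ^ d] cells. *)
Lemma unbalanced_fraction_le (R : realType) n d m' (Q : finType)
    (S : Q -> {set {ffun 'I_d -> 'I_m'.+1}}) : (0 < n)%N ->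
  #|[set y : {ffun 'I_n * 'I_d -> 'I_m'.+1} |
      [exists q, ~~ balanced (S q) (curry_ffun y)]]%SET|%:R / m'.+1%:R ^+ #|{: 'I_n * 'I_d}|
    <= (#|Q| * (4 * (m'.+1 ^ d) ^ 2))%:R / n%:R :> R.
Proof.
move=> n0; set A := [set y | _]%SET.
rewrite (card_curry_ffun (fun z => [exists q, ~~ balanced (S q) z])).
set B := [set z | _]%SET.
have cJ : #|{: {ffun 'I_d -> 'I_m'.+1}}| = (m'.+1 ^ d)%N by rewrite card_ffun !card_ord.
have le_B : (#|B| * n <= #|Q| * (4 * (m'.+1 ^ d) ^ 2) * (m'.+1 ^ d) ^ n)%N.
  pose Bq q := [set z : {ffun 'I_n -> {ffun 'I_d -> 'I_m'.+1}} | ~~ balanced (S q) z]%SET.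
  have le1 : (#|B| <= \sum_q #|Bq q|)%N.
    under eq_bigr => q _ do rewrite -sum1_card big_mkcond.
    rewrite exchange_big -sum1_card big_mkcond /=; apply: leq_sum => z _.
    rewrite inE; case: ifP => // /existsP[q uq].
    by rewrite (bigD1 q) //= inE uq.
  apply: leq_trans (leq_mul le1 (leqnn n)) _.
  rewrite big_distrl /= -mulnA -sum_nat_const; apply: leq_sum => q _.
  by rewrite -cJ card_unbalanced.
rewrite ler_pdivrMr ?exprn_gt0 // mulrAC ler_pdivlMr ?ltr0n //.
rewrite card_prod !card_ord -natrX -!natrM ler_nat [(n * d)%N]mulnC expnM.
exact: le_B.
Qed.

Lemma eucl_dist_le (R : realType) d (x y : 'I_d -> R) (c : R) : 0 <= c ->
  (forall k, `|x k - y k| <= c) -> eucl_dist x y <= Num.sqrt d%:R * c.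
Proof.
move=> c0 xy; rewrite /eucl_dist.
have -> : Num.sqrt d%:R * c = Num.sqrt (d%:R * c ^+ 2).
  by rewrite sqrtrM // sqrtr_sqr ger0_norm.
apply: ler_wsqrtr.
rewrite mulr_natl -[X in _ *+ X]card_ord -sumr_const; apply: ler_sum => k _.
by rewrite -[leLHS]real_normK ?num_real // lerXn2r ?nnegrE.
Qed.

Lemma sum_sub_le_eucl_dist (R : realType) d (x y : 'I_d -> R) :
  `|\sum_k x k - \sum_k y k| <= Num.sqrt d%:R * eucl_dist x y.
Proof.
case: d x y => [|d] x y; first by rewrite !big_ord0 subrr normr0 mulr_ge0 ?sqrtr_ge0.
rewrite /eucl_dist -sqrtrM // -sqrtr_sqr ler_wsqrtr // -sumrB.
set z := fun k => x k - y k; rewrite -/(z _).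
set S := \sum_k _; set n : R := d.+1%:R.
have n0 : 0 < n by [].
(* Cauchy-Schwarz against the all-ones vector, obtained by expanding this sum of squares. *)
have : 0 <= \sum_k (n * z k - S) ^+ 2 by apply: sumr_ge0 => k _; apply: sqr_ge0.
have -> : \sum_k (n * z k - S) ^+ 2 = n * (n * (\sum_k z k ^+ 2) - S ^+ 2).
  transitivity (\sum_k (n ^+ 2 * z k ^+ 2 + (- (n * S) * 2 * z k) + S ^+ 2)).
    by apply: eq_bigr => k _; ring.
  rewrite !big_split /= -!mulr_sumr sumr_const card_ord -mulr_natl -/n -/S; ring.
by rewrite pmulr_rge0 // subr_ge0.
Qed.

Lemma close_of_nat_close (R : realFieldType) (D a b : nat) (x y : R) :
  (a <= b + (D + 2))%N -> (b <= a + (D + 2))%N ->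
  a%:R <= x <= a.+1%:R -> b%:R <= y <= b.+1%:R -> `|x - y| <= (D + 3)%:R.
Proof.
rewrite -!(ler_nat R) !natrD -!natr1 => ab ba /andP[ax xa] /andP[b_y yb].
by rewrite ler_norml; apply/andP; split; lra.
Qed.

Lemma ntree_gt0 s h : (0 < ntree s h)%N.
Proof. by rewrite /ntree big_ord_recl expn0. Qed.

(** There are exactly [ntree s h] words of length at most [h], so an injective copy is spanning. *)
Lemma bal_tree_onto s h (phi : seq 'I_s -> 'I_(ntree s h)) :
  (forall u v, bal_tree_vertex h u -> bal_tree_vertex h v -> phi u = phi v -> u = v) ->
  forall i, exists2 w, (size w <= h)%N & phi w = i.
Proof.
move=> phi_inj i.
pose V := {l : 'I_h.+1 & l.-tuple 'I_s}.
pose word (x : V) : seq 'I_s := tagged x.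
have size_word x : size (word x) = tag x by rewrite size_tuple.
have word_inj : injective word.
  move=> x y; have := size_word x; have := size_word y.
  case: x y => [l x] [l' y] /=; rewrite /word /= => s1 s2 E.
  have El : l = l' by apply: val_inj; rewrite /= -s1 -s2 E.
  by subst l'; congr existT; apply: val_inj.
have cV : #|{: V}| = ntree s h.
  rewrite card_tagged sumnE big_map big_enum /ntree; apply: eq_bigr => l _.
  by rewrite card_tuple card_ord.
have f_inj : injective (phi \o word).
  by move=> x y /= /phi_inj E; apply/word_inj/E; rewrite /bal_tree_vertex size_word -ltnS.
have [|f fK Kf] := inj_card_bij f_inj; first by rewrite cV card_ord.
by exists (word (f i)); [rewrite size_word -ltnS | exact: Kf].
Qed.

(** Both points are reached from the image of the root in at most [h] edges. The bound [r'] keeps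
    the step length nonnegative even if [r] is negative. *)
Lemma tree_coordinate_sum_le (R : realType) s d h (r r' : R) (X : 'I_(ntree s h) -> 'I_d -> R) i j :
  0 <= r' -> r <= r' ->
  contains_copy (@bal_tree_vertex s h) (@bal_tree_edge s) (rgg_adj r X) ->
  \sum_k X i k - \sum_k X j k <= 2 * h%:R * (Num.sqrt d%:R * r').
Proof.
move=> r0 le_r [phi [phi_inj phi_adj]].
set c := Num.sqrt d%:R * r'.
have c0 : 0 <= c by rewrite mulr_ge0 // sqrtr_ge0.
have walk w : (size w <= h)%N -> `|\sum_k X (phi w) k - \sum_k X (phi [::]) k| <= (size w)%:R * c.
  elim/last_ind: w => [|w a IH]; first by rewrite subrr normr0 mul0r.
  rewrite size_rcons => lt_w.
  have [|||_ le_e] := phi_adj w (rcons w a).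
  - exact: ltnW.
  - by rewrite /bal_tree_vertex size_rcons.
  - by left; exists a.
  apply: le_trans (ler_distD (\sum_k X (phi w) k) _ _) _.
  rewrite -natr1 mulrDl mul1r addrC lerD ?IH ?(ltnW lt_w) // distrC.
  apply: le_trans (sum_sub_le_eucl_dist _ _) _.
  by rewrite ler_wpM2l ?sqrtr_ge0 // (le_trans le_e).
have bnd l : `|\sum_k X l k - \sum_k X (phi [::]) k| <= h%:R * c.
  have [w sw <-] := bal_tree_onto phi_inj l.
  by apply: le_trans (walk _ sw) _; rewrite ler_wpM2r // ler_nat.
by have := bnd i; have := bnd j; rewrite !ler_norml => /andP[? ?] /andP[? ?]; lra.
Qed.

Lemma prob_rgg_tree_le (R : realType) s d h (r r' : R) m' : 0 <= r' -> r <= r' ->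
  2 * h%:R * (Num.sqrt d%:R * r') < d%:R * (1 - 2 / m'.+1%:R) ->
  (0 <= prob_rgg_tree s d h r <=
    ((2 * (4 * (m'.+1 ^ d) ^ 2))%:R / (ntree s h)%:R : R)%:E)%E.
Proof.
move=> r0 le_r short.
pose corner (b : bool) : {ffun 'I_d -> 'I_m'.+1} := [ffun=> if b then ord_max else ord0].
pose A := [set y : {ffun 'I_(ntree s h) * 'I_d -> 'I_m'.+1} |
  [exists b, ~~ balanced [set corner b]%SET (curry_ffun y)]]%SET.
have := @unbalanced_fraction_le R _ d m' _ (fun b => [set corner b]%SET) (ntree_gt0 s h).
rewrite card_bool -lee_fin -/A => leA.
suff /andP[-> /le_trans] /= : (0 <= prob_rgg_tree s d h r <=
  (#|A|%:R / m'.+1%:R ^+ #|{: 'I_(ntree s h) * 'I_d}|)%:E)%E by apply.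
apply: unif_prob_le => x cx copy; rewrite inE; apply: contraT.
rewrite negb_exists => /forallP bal.
(* Balance for a single cell reads [2n <= 2 |J| B + n], which forces [B > 0]. *)
have hit b : exists i, forall k, cell_of m' (x (i, k)) = if b then ord_max else ord0.
  have := bal b; rewrite negbK /balanced cards1 => /andP[le _].
  have /card_gt0P[i] : (0 < #|[set i | curry_ffun (cells m' x) i \in [set corner b]%SET]%SET|)%N.
    by move: le (ntree_gt0 s h); case: #|_| => //; rewrite muln0; lia.
  rewrite !inE => /eqP E; exists i => k.
  by have := congr1 (fun c : {ffun 'I_d -> 'I_m'.+1} => c k) E; rewrite /= !ffunE.
have [i0 c_i0] := hit false; have [i1 c_i1] := hit true.
have m0 : 0 < m'.+1%:R :> R by [].
have := tree_coordinate_sum_le i1 i0 r0 le_r copy.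
rewrite leNgt => /negP[]; apply: lt_le_trans short _.
rewrite -sumrB mulr_natl -[X in _ *+ X]card_ord -sumr_const; apply: ler_sum => k _.
have /= := cell_ofP m' (cx (i1, k)); have /= := cell_ofP m' (cx (i0, k)).
rewrite c_i0 c_i1 /= => /andP[_ h1] /andP[h2 _].
rewrite -(ler_pM2l m0) mulrBr mulr1 mulrCA divff ?gt_eqF // mulr1 mulrBr.
by move: h1 h2; rewrite -[m'.+1%:R in X in _ -> _ -> X <= _]natr1; lra.
Qed.

Lemma prob_rgg_tree_ge (R : realType) s d D L e m' (r : R) :
  (1 < s)%N -> m'.+1 = (2 * D * L)%N -> (8 * m'.+1 ^ d <= s ^ e)%N ->
  Num.sqrt d%:R * ((D + 3)%:R / m'.+1%:R) <= r ->
  ((1 - (m'.+1 ^ d * (4 * (m'.+1 ^ d) ^ 2))%:R / (ntree s (L + 2 * e))%:R)%:E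
     <= prob_rgg_tree s d (L + 2 * e) r <= 1)%E.
Proof.
move=> s1 mE Ksmall le_r; set h := (L + 2 * e)%N; set K := (m'.+1 ^ d)%N.
(* The union bound runs over the initial segments of the snake. In [D + 3], one cell width is added
   for the positions of the points inside their cells. *)
pose S (q : 'I_K) := [set c : {ffun 'I_d -> 'I_m'.+1} | (snake_index c < q)%N]%SET.
pose A := [set y : {ffun 'I_(ntree s h) * 'I_d -> 'I_m'.+1} |
  [exists q, ~~ balanced (S q) (curry_ffun y)]]%SET.
have := @unbalanced_fraction_le R _ d m' _ S (ntree_gt0 s h).
rewrite card_ord -/A -/K => leA.
suff /andP[geA ->] : ((1 - #|A|%:R / m'.+1%:R ^+ #|{: 'I_(ntree s h) * 'I_d}|)%:E
    <= prob_rgg_tree s d h r <= 1)%E.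
  by rewrite andbT; apply: le_trans geA; rewrite lee_fin lerD2l lerN2.
apply: unif_prob_ge => x cx; rewrite inE negb_exists => /forallP bal.
pose g i : {ffun 'I_d -> 'I_m'.+1} := curry_ffun (cells m' x) i.
have [t lt_t|phi [phi_inj phi_close]] := @tree_embedding s d D L e m' s1 mE Ksmall g.
  have /negbNE := bal (Ordinal lt_t).
  rewrite /balanced /S (card_snake_index_lt (ltnW lt_t)) card_ffun !card_ord -/K.
  have -> : [set i | curry_ffun (cells m' x) i \in
      [set c : {ffun 'I_d -> 'I_m'.+1} | (snake_index c < t)%N]]%SET =
     [set i | (snake_index (g i) < t)%N]%SET by apply/setP => i; rewrite !inE.
  by move/andP.
have m0 : 0 < m'.+1%:R :> R by [].
have adj u a : (size u < h)%N -> eucl_dist (fun k => x (phi u, k)) (fun k => x (phi (rcons u a), k)) <= r.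
  move=> lt_u; apply: le_trans (eucl_dist_le _ _) le_r; first by rewrite divr_ge0.
  move=> k; have [] := phi_close u a k lt_u.
  rewrite /g /curry_ffun !ffunE /= => c1 c2.
  have /andP[a1 a2] := cell_ofP m' (cx (phi u, k)).
  have /andP[b1 b2] := cell_ofP m' (cx (phi (rcons u a), k)).
  rewrite ler_pdivlMr // -[X in _ * X](ger0_norm (ltW m0)) -normrM mulrC mulrBr.
  by apply: (@close_of_nat_close _ D) c1 c2 _ _; rewrite ?a1 ?b1.
have dist_sym i j : eucl_dist (fun k => x (i, k)) (fun k => x (j, k)) =
    eucl_dist (fun k => x (j, k)) (fun k => x (i, k)).
  by rewrite /eucl_dist; congr Num.sqrt; apply: eq_bigr => k _; rewrite -sqrrN opprB.
exists phi; split; first exact: phi_inj.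
move=> u v Vu Vv [[a E]|[a E]]; subst; split.
- apply/eqP => /(phi_inj _ _ Vu Vv) /(congr1 size); rewrite size_rcons; lia.
- by apply: adj; move: Vv; rewrite /bal_tree_vertex size_rcons.
- apply/eqP => /(phi_inj _ _ Vu Vv) /(congr1 size); rewrite size_rcons; lia.
- by rewrite dist_sym; apply: adj; move: Vu; rewrite /bal_tree_vertex size_rcons.
Qed.

(** * Choice of parameters and passage to the limit *)

Lemma poly_le_expn (C p q : nat) : (0 < q)%N ->
  exists N, forall h, (N <= h)%N -> (C * h ^ p <= 2 ^ (h %/ q))%N.
Proof.
(* With [a = h %/ Q], the power [2 ^ (a * p.+1)] has one factor [2 ^ a] to beat the constant [B] and
   [p] factors to beat [h ^ p], as [h <= Q * 2 ^ a]. *)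
move=> q0; set Q := (q * p.+1)%N; set B := (C * Q ^ p)%N.
have Q0 : (0 < Q)%N by rewrite muln_gt0 q0.
exists (B * Q)%N => h le_h; set a := (h %/ Q)%N.
have le_B : (B <= 2 ^ a)%N by apply: leq_trans (ltnW (ltn_expl _ (ltnSn 1))); rewrite leq_divRL.
have le_Q : (h <= Q * 2 ^ a)%N.
  apply: leq_trans (ltnW (ltn_ceil h Q0)) _; rewrite mulnC leq_mul2l.
  by rewrite (ltn_expl a (ltnSn 1)) orbT.
apply: (@leq_trans (2 ^ (a * p.+1))); last first.
  rewrite leq_exp2l // leq_divRL // -mulnA [(p.+1 * q)%N]mulnC.
  exact: leq_divM.
apply: leq_trans (leq_mul (leqnn C) (_ : h ^ p <= (Q * 2 ^ a) ^ p)%N) _.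
  by case: (p) => // p'; rewrite leq_exp2r.
by rewrite expnMn mulnA mulnS expnD -expnM leq_mul2r -/B le_B orbT.
Qed.

Lemma ntree_ge_expn s h : (s ^ h <= ntree s h)%N.
Proof. by rewrite /ntree big_ord_recr /= leq_addl. Qed.

Lemma ltn_ntree s h : (1 < s)%N -> (h < ntree s h)%N.
Proof. by move=> s1; apply: leq_trans (ltn_expl h s1) (ntree_ge_expn s h). Qed.

Lemma cvg_harmonic_mul (R : realType) (c b : R) :
  (c + b * harmonic h)%:E @[h --> \oo] --> c%:E.
Proof.
apply: cvg_EFin; first by near=> h.
rewrite -[X in _ --> X]addr0 -(mulr0 b); apply: cvgD; first exact: cvg_cst.
by apply: cvgMl_tmp; apply: cvg_harmonic.
Unshelve. all: by end_near. Qed.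

Lemma subcritical_radius (R : realType) (s d : nat) (eps : R) (r : nat -> R) :
  (2 <= s)%N -> (0 < d)%N -> 0 < eps < 1 ->
  (forall h : nat, (0 < h)%N -> r h <= (1 - eps) * rstar R d h) ->
  prob_rgg_tree s d h (r h) @[h --> \oo] --> 0%E.
Proof.
move=> s1 d0 /andP[eps0 eps1] r_le.
(* At radius [(1 - eps) * rstar] the tree spans a coordinate sum of at most [(1 - eps) * d], while
   the corner cells differ by at least [d * (1 - 2 / m)]; so [2 / m < eps] is wanted. *)
set m' := Num.trunc (2 / eps).
have m_large : 2 / m'.+1%:R < eps.
  rewrite ltr_pdivrMr // mulrC -ltr_pdivrMr //; exact: truncnS_gt.
set c : nat := (2 * (4 * (m'.+1 ^ d) ^ 2))%N.
apply: (@squeeze_cvge _ _ _ _ (fun=> 0%E) _ (fun h => (0 + c%:R * harmonic h)%:E)).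
- near=> h.
  have h0 : (0 < h)%N by near: h; exists 1%N.
  have hR : 0 < h%:R :> R by rewrite ltr0n.
  have r0 : 0 <= (1 - eps) * rstar R d h.
    apply: mulr_ge0; first by rewrite subr_ge0 ltW.
    by rewrite divr_ge0 ?sqrtr_ge0 ?mulr_ge0.
  have short : 2 * h%:R * (Num.sqrt d%:R * ((1 - eps) * rstar R d h)) < d%:R * (1 - 2 / m'.+1%:R).
    have -> : 2 * h%:R * (Num.sqrt d%:R * ((1 - eps) * rstar R d h)) =
        (1 - eps) * Num.sqrt d%:R ^+ 2.
      by rewrite /rstar; field; rewrite gt_eqF.
    by rewrite sqr_sqrtr // mulrC ltr_pM2l ?ltr0n // ltrD2l ltrN2.
  have /andP[-> /le_trans] /= := @prob_rgg_tree_le R s d h (r h) _ m' r0 (r_le h h0) short.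
  apply; rewrite lee_fin add0r ler_wpM2l // lef_pV2 ?posrE ?ltr0n ?ntree_gt0 //.
  by rewrite ler_nat ltn_ntree.
- exact: cvg_cst.
- exact: cvg_harmonic_mul.
Unshelve. all: by end_near. Qed.

Lemma supercritical_radius (R : realType) (s d : nat) (eps : R) (r : nat -> R) :
  (2 <= s)%N -> (0 < d)%N -> 0 < eps ->
  (forall h : nat, (0 < h)%N -> (1 + eps) * rstar R d h <= r h) ->
  prob_rgg_tree s d h (r h) @[h --> \oo] --> 1%E.
Proof.
move=> s1 d0 eps0 r_ge.
(* Here [k] serves as the step length [D]. With [k * L >= h * (k - 1)], short edges require
   [k + 3 <= (1 + eps) * (k - 1)], which is this inequality. *)
have [k k2 k_large] : exists2 k : nat, (2 <= k)%N & 4 <= eps * (k%:R - 1).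
  exists (Num.trunc (4 / eps)).+2 => //.
  by rewrite [X in X - _]mulrSr addrK mulrC -ler_pdivrMr // ltW // truncnS_gt.
(* Since [m <= 2 * k * h], this yields [8 * K <= s ^ e] for [e = h %/ (2 * k)]. *)
have [N N_large] := @poly_le_expn (8 * (2 * k) ^ d) d (2 * k) (leq_mul (isT : (0 < 2)%N) (ltnW k2)).
apply: (@squeeze_cvge _ _ _ _ (fun h => (1 + (-1) * harmonic h)%:E) _ (fun=> 1%E)).
- near=> h.
  have h0 : (0 < h)%N by near: h; exists 1%N.
  have hN : (N <= h)%N by near: h; exists N.
  have {N_large}large := N_large h hN.
  set e := (h %/ (2 * k))%N in large.
  have le_e : (2 * k * e <= h)%N by rewrite mulnC leq_divM.
  have le_2e : (2 * e <= h)%N by nia.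
  pose L := (h - 2 * e)%N.
  have hE : h = (L + 2 * e)%N by rewrite subnK.
  have kL : (h * (k - 1) <= k * L)%N by rewrite hE in le_e *; nia.
  pose m' := (2 * k * L).-1.
  have L0 : (0 < L)%N by nia.
  have mE : m'.+1 = (2 * k * L)%N by rewrite prednK //; nia.
  set K := (m'.+1 ^ d)%N.
  have Ksmall : (8 * K <= s ^ e)%N.
    apply: leq_trans (leq_trans _ large) _; last by case: (e) => // e'; rewrite leq_exp2r.
    by rewrite -mulnA leq_mul2l -expnMn /K mE leq_exp2r // leq_mul2l hE leq_addr orbT.
  have close : Num.sqrt d%:R * ((k + 3)%:R / m'.+1%:R) <= r h.
    apply: le_trans (r_ge h h0); rewrite /rstar [leRHS]mulrCA ler_wpM2l ?sqrtr_ge0 // mE.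
    have L0' : 0 < L%:R :> R by rewrite ltr0n.
    have h0' : 0 < h%:R :> R by rewrite ltr0n.
    rewrite ler_pdivlMr ?mulr_gt0 // mulrAC ler_pdivrMr ?ltr0n ?muln_gt0 ?L0 ?(ltnW k2) //.
    have kLR : h%:R * (k%:R - 1) <= k%:R * L%:R :> R.
      by have := kL; rewrite -(ler_nat R) !natrM natrB // ltnW.
    rewrite natrD !natrM.
    have : h%:R * (k%:R + 3) <= (1 + eps) * (h%:R * (k%:R - 1)) :> R.
      by rewrite mulrCA ler_wpM2l //; lra.
    have : (1 + eps) * (h%:R * (k%:R - 1)) <= (1 + eps) * (k%:R * L%:R) :> R.
      by rewrite ler_wpM2l //; lra.
    by move: kLR => _; lra.
  have := @prob_rgg_tree_ge R s d k L e m' (r h) s1 mE Ksmall close.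
  rewrite -hE -/K => /andP[lb ->]; rewrite andbT; apply: le_trans lb.
  rewrite lee_fin mulN1r lerD2l lerN2 /harmonic /=.
  have n0 := ntree_gt0 s h.
  rewrite ler_pdivrMr ?ltr0n // mulrC ler_pdivlMr // -natrM ler_nat.
  have le_kL : (h <= k * L)%N by apply: leq_trans kL; rewrite leq_pmulr // subn_gt0.
  (* The failure bound [4 * K ^ 3 / n] is at most [1 / (h + 1)], because [4 * K ^ 3 * (h + 1) <= (8
     * K) ^ 4 <= s ^ (4 * e) <= s ^ h <= n]. *)
  have hK : (h < K)%N.
    apply: (@leq_trans m'.+1); first by rewrite mE -mulnA; lia.
    by rewrite -[leqLHS]expn1 /K leq_pexp2l.
  apply: leq_trans (ntree_ge_expn s h).
  have le_4e : (e * 4 <= h)%N.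
    apply: leq_trans le_e; rewrite [(e * 4)%N]mulnC leq_mul2r; apply/orP; right.
    by lia.
  apply: leq_trans (leq_pexp2l (ltnW s1) le_4e); rewrite expnM.
  apply: leq_trans (_ : (8 * K) ^ 4 <= _)%N; last by rewrite leq_exp2r.
  apply: (@leq_trans (4 * K ^ 3 * K)); first by rewrite [(K ^ 3)%N]expnS mulnCA leq_mul2l hK orbT.
  by rewrite expnMn -mulnA -expnSr leq_mul2r orbT.
- exact: cvg_harmonic_mul.
- exact: cvg_cst.
Unshelve. all: by end_near. Qed.

Theorem theorem1p1 (R : realType) (s d : nat) :
  (2 <= s)%N -> (0 < d)%N ->
  forall eps : R, 0 < eps < 1 ->
  (forall r : nat -> R,
     (forall h : nat, (0 < h)%N -> r h <= (1 - eps) * rstar R d h) ->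
     prob_rgg_tree s d h (r h) @[h --> \oo] --> 0%E) /\
  (forall r : nat -> R,
     (forall h : nat, (0 < h)%N -> (1 + eps) * rstar R d h <= r h) ->
     prob_rgg_tree s d h (r h) @[h --> \oo] --> 1%E).
Proof.
move=> s2 d0 eps eps01.
split=> r; first exact: subcritical_radius.
by apply: supercritical_radius => //; case/andP: eps01.
Qed.
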